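(* Let $X,Y$ be real Banach spaces, let $T\in\mathcal{L}(X,Y)$, and let $\mathcal{I},\mathcal{J}$ be ideals on $\omega$ such that $\mathcal{J}$ is strongly selective. Then a matrix $A=(A_{n,k}:n,k\in\omega)$ of linear operators in $\mathcal{L}(X,Y)$ satisfies $$A\in(c^b(X,\mathcal{I}),c(Y,\mathcal{J}))\ \text{ and }\ \mathcal{J}\text{-}\lim A\boldsymbol{x}=T(\mathcal{I}\text{-}\lim\boldsymbol{x})\ \text{ for all }\boldsymbol{x}\in c^b(X,\mathcal{I})$$ if and only if there exists $k_0\in\omega$ such that all of the following hold: (T1$^\flat$) there exists $J_0\in\mathcal{J}^\star$ for which $\sup_{n\in J_0}\|A_{n,\ge k_0}\|<\infty$ and, for all $n\in\omega\setminus J_0$, there exists $f(n)\in\omega$ such that $\|A_{n,\ge f(n)}\|<\infty$; (T3) $\sum_kA_{n,k}x_k$ converges in the norm of $Y$ for all $\boldsymbol{x}\in c^b(X,\mathcal{I})$ and $n\in\omega$; (T4) $\mathcal{J}\text{-}\lim_n\sum_kA_{n,k}=T$; (T5) $A\in(c_{00}^b(X,\mathcal{I}),c_0(Y,\mathcal{J}))$. In addition, if each $A_{n,k}$ is bounded, it is possible to choose $k_0=f(n)=0$ for all $n\in\omega\setminus J_0$.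
   Context: $\omega$ is the set of nonnegative integers. An ideal on $\omega$ is a family of subsets of $\omega$ closed under subsets and finite unions; every ideal is assumed to contain all finite sets and to differ from the power set of $\omega$. $\mathcal{J}^\star=\{S\subseteq\omega:\omega\setminus S\in\mathcal{J}\}$, $\mathcal{J}^+=\{S\subseteq\omega:S\notin\mathcal{J}\}$. An ideal $\mathcal{J}$ is strongly selective if for every decreasing sequence $(S_n)$ in $\mathcal{J}^+$ there is $S=\{x_n:n\in\omega\}\in\mathcal{J}^+$ (with $(x_n)$ the increasing enumeration of $S$) such that $x_{n+1}\in S_{x_n}$ for all $n\in\omega$. $\mathcal{I}\text{-}\lim_nx_n=\eta$ means $\{n:x_n\notin U\}\in\mathcal{I}$ for every neighborhood $U$ of $\eta$. For a Banach space $V$: $\ell_\infty(V)$ is the space of norm-bounded sequences; $c(V,\mathcal{I})$ the $\mathcal{I}$-convergent sequences; $c_0(V,\mathcal{I})$ those with $\mathcal{I}$-limit $0$; $c_{00}(V,\mathcal{I})$ those with $\{n:x_n\ne0\}\in\mathcal{I}$; $c^b(V,\mathcal{I})=c(V,\mathcal{I})\cap\ell_\infty(V)$, $c_{00}^b(V,\mathcal{I})=c_{00}(V,\mathcal{I})\cap\ell_\infty(V)$. $\mathcal{L}(X,Y)$ is the space of all (not necessarily bounded) linear operators $X\to Y$, with the strong operator topology. For $E\subseteq\omega$, the group norm is $\|A_{n,E}\|=\sup\{\|\sum_{k\in F}A_{n,k}x_k\|:F\subseteq E\text{ finite},\ x_k\in X,\ \|x_k\|\le1\}\in[0,\infty]$;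 $A_{n,\ge k}=A_{n,\{k,k+1,\dots\}}$. $A\boldsymbol{x}=(A_n\boldsymbol{x})_n$, $A_n\boldsymbol{x}=\sum_kA_{n,k}x_k$, provided each series converges in norm. $A\in(\mathscr{A},\mathscr{B})$ means that $A\boldsymbol{x}$ is well defined and in $\mathscr{B}$ for every $\boldsymbol{x}\in\mathscr{A}$. $\mathcal{J}\text{-}\lim_n\sum_kA_{n,k}=T$ means: for all $x\in X$ and $n\in\omega$ the series $\sum_kA_{n,k}x$ converges in norm, and $\mathcal{J}\text{-}\lim_n\sum_kA_{n,k}x=Tx$ for all $x\in X$. *)

(* Defs.v *)
From HB Require Import structures.
From mathcomp Require Import all_boot all_order all_algebra finmap.
From mathcomp Require Import all_classical all_reals all_analysis.

Set Implicit Arguments.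
Unset Strict Implicit.
Unset Printing Implicit Defensive.

Import Order.TTheory GRing.Theory Num.Theory.
Import numFieldNormedType.Exports.

Local Open Scope classical_set_scope.
Local Open Scope ring_scope.

Definition ideal (I : set (set nat)) : Prop :=
  [/\ forall S S' : set nat, S `<=` S' -> I S' -> I S,
      forall S S' : set nat, I S -> I S' -> I (S `|` S'),
      forall S : set nat, finite_set S -> I S
    & I <> setT].

Definition ideal_dual (I : set (set nat)) : set (set nat) :=
  [set S | I (~` S)].

Definition ideal_positive (I : set (set nat)) : set (set nat) :=
  [set S | ~ I S].

(* The set S of the definition is range x; elements of ideal_positive J are
   infinite when J is an ideal, so S always has an increasing enumeration x. *)
Definition strongly_selective (J : set (set nat)) : Prop :=
  forall S : nat -> set nat,
    (forall n, ideal_positive J (S n)) ->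
    (forall n, S n.+1 `<=` S n) ->
    exists x : nat -> nat,
      [/\ forall n, (x n < x n.+1)%N,
          ideal_positive J (range x)
        & forall n, S (x n) (x n.+1)].

Definition ideal_lim {V : topologicalType} (I : set (set nat))
    (x : nat -> V) (eta : V) : Prop :=
  forall U : set V, nbhs eta U -> I [set n | ~ U (x n)].

Section SequenceSpaces.
Context {R : realType} (V : normedModType R) (I : set (set nat)).

Definition ell_infty : set (nat -> V) := [set x | bounded_fun x].

Definition c_seq : set (nat -> V) := [set x | exists eta, ideal_lim I x eta].

Definition c0_seq : set (nat -> V) := [set x | ideal_lim I x 0].

Definition c00_seq : set (nat -> V) := [set x | I [set n | x n <> 0]].

Definition cb_seq : set (nat -> V) := c_seq `&` ell_infty.

Definition c00b_seq : set (nat -> V) := c00_seq `&` ell_infty.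

End SequenceSpaces.

Arguments ell_infty {R} V.
Arguments c_seq {R} V I.
Arguments c0_seq {R} V I.
Arguments c00_seq {R} V I.
Arguments cb_seq {R} V I.
Arguments c00b_seq {R} V I.

Section OperatorMatrices.
Context {R : realType} {X Y : normedModType R}.

Definition group_norm (B : nat -> {linear X -> Y}) (E : set nat) : \bar R :=
  ereal_sup [set u : \bar R | exists (F : {fset nat}) (x : nat -> X),
    [/\ [set` F] `<=` E,
        forall k, `|x k| <= 1
      & u = (`|\sum_(k <- F) B k (x k)|)%:E]].

Definition tail_group_norm (B : nat -> {linear X -> Y}) (k : nat) : \bar R :=
  group_norm B [set j | (k <= j)%N].

Variable A : nat -> nat -> {linear X -> Y}.

Definition row_series (n : nat) (x : nat -> X) : nat -> Y :=
  series (fun k => A n k (x k)).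

Definition row_converges (n : nat) (x : nat -> X) : Prop :=
  cvgn (row_series n x).

(* Meaningful only when row_converges n x holds for every n: limn returns a
   default value on divergent series. *)
Definition mxapply (x : nat -> X) : nat -> Y :=
  fun n => limn (row_series n x).

Definition mx_class (P : set (nat -> X)) (Q : set (nat -> Y)) : Prop :=
  forall x, P x -> (forall n, row_converges n x) /\ Q (mxapply x).

Definition row_sums_lim (J : set (set nat)) (T : {linear X -> Y}) : Prop :=
  forall x : X, (forall n, row_converges n (fun=> x)) /\
    ideal_lim J (mxapply (fun=> x)) (T x).

Definition regular_wrt (T : {linear X -> Y}) (I J : set (set nat)) : Prop :=
  mx_class (cb_seq X I) (c_seq Y J) /\
  forall (x : nat -> X) (eta : X), cb_seq X I x -> ideal_lim I x eta ->
    ideal_lim J (mxapply x) (T eta).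

Definition T1flat (J : set (set nat)) (k0 : nat) (f : nat -> nat) : Prop :=
  exists J0 : set nat,
    [/\ ideal_dual J J0,
        (ereal_sup [set tail_group_norm (A n) k0 | n in J0] < +oo)%E
      & forall n, ~ J0 n -> (tail_group_norm (A n) (f n) < +oo)%E].

Definition T3 (I : set (set nat)) : Prop :=
  forall x, cb_seq X I x -> forall n, row_converges n x.

Definition T4 (J : set (set nat)) (T : {linear X -> Y}) : Prop :=
  row_sums_lim J T.

Definition T5 (I J : set (set nat)) : Prop :=
  mx_class (c00b_seq X I) (c0_seq Y J).

End OperatorMatrices.

(* Main.v *)
Require Import Defs.
From HB Require Import structures.
From mathcomp Require Import all_boot all_order all_algebra finmap.
From mathcomp Require Import all_classical all_reals all_analysis.
From mathcomp Require Import lra.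

Import Order.TTheory GRing.Theory Num.Theory numFieldNormedType.Exports.
Local Open Scope classical_set_scope.
Local Open Scope ring_scope.

(** Sufficiency is a splitting argument. Given a bounded [x] with ideal limit
    [eta], write [x = eta + u + v], where [v] collects the terms of [x - eta]
    of index below [k0] or of norm at least [eps]. The constant part is handled
    by T4 and [v], which is carried by a set of the ideal, by T5. On the rows of
    [J0], the group norm bounds the contribution of the small remainder [u] by
    a constant times [eps].

    For necessity only T1flat needs work, and the single fact used about the
    matrix is that it sends norm-null sequences of [X] to sequences with
    [J]-limit [0] ([maps_null_to_null]). Two gliding humps give T1flat.

    In a fixed row, if no tail had finite group norm, there would be consecutive
    finite blocks on which unit vectors yield arbitrarily large sums; scaling
    them down to a null sequence contradicts convergence of the row
    ([row_tail_finite]). This provides the function [f].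

    Across rows, the claim is a uniform boundedness principle for ideals
    ([J_bounded_group_norm]). Suppose the row norms on sets [E m], on which
    the rows of index at most [m] are known to have finite norm, are unbounded
    on a [J]-positive set of rows for every [m]. For each pair [(m, n)] fix in
    advance a finitely supported hump, which is large in row [n] when possible.
    The image of each hump tends to [0] along [J], so the images of finitely
    many humps are small outside a set of [J]. Strong selectivity then gives
    rows [r 0 < r 1 < ...], together a [J]-positive set, such that row [r i.+1]
    is large on the hump of index [(r i, r i.+1)] and small on all earlier
    humps; the rapidly decreasing weights make the later humps harmless. The
    weighted sum of the humps is a null sequence whose image stays away from [0]
    on a [J]-positive set. Fixing the humps before selecting the rows is what
    makes the selection possible, because the positive sets in strong
    selectivity may only depend on the last chosen row.

    With [E m] a tail of the integers this gives T1flat for arbitrary linear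
    operators; with [E m] the set of all integers, which is allowed when the
    entries are bounded, it gives T1flat with [k0 = f n = 0]. The humps may
    overlap, so their weighted sum exists by completeness of [X] and not because
    the supports are disjoint. *)

(** * Ideals and ideal limits *)

Section IdealLimits.
Context {R : realType} {V : normedModType R} {I : set (set nat)}.

Lemma ideal_limP (x : nat -> V) (eta : V) : ideal I ->
  ideal_lim I x eta <-> forall e : R, 0 < e -> I [set n | e <= `|x n - eta|].
Proof.
move=> [sub _ _ _]; split=> [xeta e e0|xeta U].
- apply: sub (xeta (ball eta e) _); last exact: nbhsx_ballx.
  by move=> n /=; rewrite -ball_normE /= distrC; case: ltP.
- move=> /nbhs_ballP [e /= e0 eU]; apply: sub (xeta e e0) => n /= nU.
  rewrite leNgt; apply/negP => xne; apply/nU/eU.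
  by rewrite -ball_normE /= distrC.
Qed.

Lemma cvg_ideal_lim (x : nat -> V) (eta : V) : ideal I ->
  x @ \oo --> eta -> ideal_lim I x eta.
Proof.
move=> hI /cvgrPdist_lt xeta; apply/ideal_limP => // e /xeta [N _ Nx].
case: hI => [sub _ fin _]; apply: (sub _ `I_N) (fin _ (finite_II N)) => n /=.
by rewrite ltnNge distrC leNgt => /negP nx; apply/negP => /Nx.
Qed.

Lemma cvg_cb_seq (x : nat -> V) : ideal I -> cvgn x -> cb_seq V I x.
Proof.
move=> hI cx; split; last exact: cvg_seq_bounded.
by exists (limn x); exact: cvg_ideal_lim.
Qed.

Lemma ideal_bigcup (n : nat) (S : nat -> set nat) : ideal I ->
  (forall k, (k < n)%N -> I (S k)) -> I (\bigcup_(k in `I_n) S k).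
Proof.
move=> [sub U fin _]; elim: n => [|n IHn] IS.
  by apply: (sub _ set0) (fin _ (finite_set0 _)) => j [].
apply: sub (U _ _ (IHn _) (IS n _)) => //; last by move=> k kn; apply/IS/ltnW.
move=> j [k /=]; rewrite ltnS leq_eqVlt => /orP[/eqP-> ?|kn ?]; first by right.
by left; exists k.
Qed.

End IdealLimits.

(** * The group norm *)

Section GroupNorm.
Context {R : realType} {X Y : normedModType R}.
Implicit Types (B : nat -> {linear X -> Y}) (E : set nat).

(** A large group norm is exhibited by a finitely supported sequence, hence by
    a null sequence to which the matrix can be applied. *)
Lemma group_norm_witness B E (M : R) : (M%:E < group_norm B E)%E ->
  exists z : nat -> X, exists L : nat,
    [/\ forall k, `|z k| <= 1, forall k, ~ E k -> z k = 0,
        forall k, (L <= k)%N -> z k = 0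
      & M < `|\sum_(0 <= k < L) B k (z k)|].
Proof.
move=> /ereal_sup_gt [_ [F [x [FE x1 ->]]]]; rewrite lte_fin => MF.
pose z k := if k \in F then x k else 0.
exists z, (\max_(k <- F) k).+1; split=> [k|k nEk|k Lk|].
- by rewrite /z; case: ifP => // _; rewrite normr0.
- by rewrite /z; case: ifP => // kF; exfalso; apply/nEk/FE.
- rewrite /z; case: ifP => // kF; move: Lk.
  by rewrite ltnNge (leq_bigmax_seq (P := predT) (F := id)).
- apply: (lt_le_trans MF); rewrite le_eqVlt; apply/orP; left; apply/eqP.
  congr (`|_|); transitivity (\sum_(0 <= k < (\max_(k <- F) k).+1 | k \in F)
      B k (z k)); last first.
    rewrite [RHS](bigID (fun k => k \in F)) /= [X in _ + X]big1 ?addr0 // => k.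
    by rewrite /z => /negbTE ->; rewrite linear0.
  rewrite -big_filter (perm_big
    [seq k <- index_iota 0 (\max_(k <- F) k).+1 | k \in F]).
    by rewrite !big_filter; apply: eq_bigr => k kF; rewrite /z kF.
  apply: uniq_perm => [||k]; rewrite ?fset_uniq ?filter_uniq ?iota_uniq //.
  rewrite mem_filter mem_index_iota; case: (boolP (k \in F)) => //= kF.
  by rewrite ltnS (leq_bigmax_seq (P := predT) (F := id)).
Qed.

(** The group norm acts as the operator norm from the bounded sequences carried
    by [E] with the supremum norm; the bound follows by rescaling [t]. *)
Lemma group_norm_sum B E (a c : R) (t : nat -> X) (N : nat) :
  (group_norm B E <= a%:E)%E -> (forall k, `|t k| <= c) ->
  (forall k, ~ E k -> t k = 0) -> `|\sum_(0 <= k < N) B k (t k)| <= a * c.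
Proof.
move=> Ba tc tE; have c0 : 0 <= c by apply: le_trans (tc 0%N).
pose F := [fset k in iota 0 N | `[< E k >]]%fset.
have -> : \sum_(0 <= k < N) B k (t k) = \sum_(k <- F) B k (t k).
  rewrite (bigID (fun k => `[< E k >])) /= [X in _ + X]big1 ?addr0; last first.
    by move=> k /asboolP /tE ->; rewrite linear0.
  rewrite -big_filter; apply: perm_big; apply: uniq_perm => [||k].
  - by rewrite filter_uniq ?iota_uniq.
  - exact: fset_uniq.
  - by rewrite mem_filter mem_index_iota /F !inE /= mem_iota /= add0n andbC.
(* No rescaling is possible when c = 0, but then t vanishes. *)
move: c0; rewrite le_eqVlt => /orP[/eqP c0|c0].
  rewrite big1 ?normr0 -?c0 ?mulr0 // => k _.
  suff -> : t k = 0 by rewrite linear0.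
  by apply/eqP; rewrite -normr_le0 c0.
have -> : \sum_(k <- F) B k (t k) = c *: \sum_(k <- F) B k (c^-1 *: t k).
  rewrite scaler_sumr; apply: eq_bigr => k _.
  by rewrite linearZ_LR scalerA divff ?scale1r // gt_eqF.
rewrite normrZ gtr0_norm // mulrC ler_pM2r // -lee_fin; apply: le_trans Ba.
apply: ereal_sup_ubound; exists F, (fun k => c^-1 *: t k); split=> // [k|k].
- by rewrite /= !inE => /andP[_ /asboolP].
- by rewrite normrZ ger0_norm ?invr_ge0 ?(ltW c0) // mulrC ler_pdivrMr // mul1r.
Qed.

Lemma group_norm_ge0 B E : (0 <= group_norm B E)%E.
Proof.
apply: ereal_sup_ubound; exists fset0, (fun=> 0); split=> [k|k|] //=.
  by rewrite normr0.
by rewrite big_seq_fset0 normr0.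
Qed.

Lemma group_norm_le B E E' : E `<=` E' ->
  (group_norm B E <= group_norm B E')%E.
Proof.
move=> EE'; apply: ereal_sup_le => _ [F [x [FE x1 ->]]].
by exists F, x; split=> //; exact: subset_trans EE'.
Qed.

Lemma group_norm_fin B E : (group_norm B E < +oo)%E ->
  exists2 a : R, 0 <= a & (group_norm B E <= a%:E)%E.
Proof.
have := group_norm_ge0 B E; case: (group_norm B E) => // r r0 _.
by exists r; rewrite ?lee_fin // -lee_fin.
Qed.

End GroupNorm.

(** Adjoining one bounded operator to a row changes a finite group norm by at
    most the norm of that operator. *)
Lemma tail_group_norm_bounded {R : realType} {X Y : normedModType R}
    (B : nat -> {linear X -> Y}) (k : nat) :
  (forall k, bounded_fun_norm (B k)) -> (tail_group_norm B k < +oo)%E ->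
  (tail_group_norm B 0 < +oo)%E.
Proof.
move=> Bb; elim: k => // k IHk /group_norm_fin[a _ Ba]; apply: IHk.
have [C BC] := Bb k 1.
apply: (@le_lt_trans _ _ (C + a)%:E); last exact: ltry.
rewrite leNgt; apply/negP => /group_norm_witness [z [L [z1 zk _]]].
rewrite ltNge => /negP; apply.
pose z2 j := if j == k then 0 else z j.
have -> : \sum_(0 <= j < L) B j (z j) =
    \sum_(0 <= j < L) (if j == k then B k (z k) else 0) +
    \sum_(0 <= j < L) B j (z2 j).
  rewrite -big_split /=; apply: eq_bigr => j _; rewrite /z2.
  by case: eqP => [->|_]; rewrite ?linear0 ?addr0 ?add0r.
apply: le_trans (ler_normD _ _) _; apply: lerD.
  have BC1 : `|B k (z k)| <= C by exact: BC.
  rewrite -big_mkcond big_nat1_eq; case: ifP => // _.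
  by rewrite normr0 (le_trans _ BC1).
rewrite -[a]mulr1; apply: (group_norm_sum B _ a 1 z2 L Ba) => j.
  by rewrite /z2; case: ifP; rewrite ?normr0.
rewrite /z2 /=; case: eqP => // jk nkj; apply: zk => /=.
by rewrite leq_eqVlt eq_sym => /orP[/eqP|].
Qed.

(** * Convergence of rows *)

Lemma lim_norm_le {R : realType} {Y : normedModType R} (u : nat -> Y)
    (c : R) : cvgn u ->
  (\forall N \near \oo, `|u N| <= c) -> `|limn u| <= c.
Proof.
move=> cu uc; have nu : `|u N| @[N --> \oo] --> `|limn u| by exact: cvg_norm.
rewrite -(cvg_lim (@Rhausdorff R) nu).
by apply: limr_le => //; exact: cvgP nu.
Qed.

Section Rows.
Context {R : realType} {X Y : normedModType R}.
Variable A : nat -> nat -> {linear X -> Y}.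
Implicit Types x y z t : nat -> X.

Lemma row_cvgD n x y u v :
  row_series A n x @ \oo --> u -> row_series A n y @ \oo --> v ->
  row_series A n (fun k => x k + y k) @ \oo --> u + v.
Proof.
move=> xu yv; have -> : row_series A n (fun k => x k + y k) =
    row_series A n x \+ row_series A n y.
  apply/funext => N; rewrite /row_series /series /= -big_split /=.
  by apply: eq_bigr => k _; rewrite linearD.
exact: cvgD.
Qed.

Lemma row_cvgZ n c x u : row_series A n x @ \oo --> u ->
  row_series A n (fun k => c *: x k) @ \oo --> c *: u.
Proof.
move=> xu; have -> : row_series A n (fun k => c *: x k) =
    (fun N => c *: row_series A n x N).
  apply/funext => N; rewrite /row_series /series /= scaler_sumr.
  by apply: eq_bigr => k _; rewrite linearZ_LR.
exact: cvgZl_tmp.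
Qed.

Lemma row_cvg_finsupp n z (L : nat) : (forall k, (L <= k)%N -> z k = 0) ->
  row_series A n z @ \oo --> \sum_(0 <= k < L) A n k (z k).
Proof.
move=> zL; apply: cvg_near_cst; exists L => // N /= LN.
rewrite /row_series /series /= (big_cat_nat (leq0n L) LN) //=.
rewrite [X in _ + X]big_nat_cond [X in _ + X]big1 ?addr0 // => k.
by move=> /andP[/andP[Lk _] _]; rewrite zL ?linear0.
Qed.

Lemma mxapply_bound n (E : set nat) (a c : R) t u :
  (group_norm (A n) E <= a%:E)%E -> (forall k, `|t k| <= c) ->
  (forall k, ~ E k -> t k = 0) -> row_series A n t @ \oo --> u ->
  `|u| <= a * c.
Proof.
move=> Aa tc tE tu; rewrite -(cvg_lim _ tu) //; apply: lim_norm_le.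
  exact: cvgP tu.
by apply: nearW => N; apply: group_norm_sum tE.
Qed.

End Rows.

(** * A tail of each row has finite group norm *)

(** Gliding hump within one row: block [j] carries a hump of norm at most
    [j.+1^-1] whose sum exceeds [1] in norm, so a null sequence would have
    a row series violating the Cauchy criterion. *)
Lemma row_tail_finite {R : realType} {X Y : normedModType R}
    (B : nat -> {linear X -> Y}) :
  (forall x : nat -> X, x @ \oo --> 0 -> cvgn (series (fun k => B k (x k)))) ->
  exists k, (tail_group_norm B k < +oo)%E.
Proof.
move=> Bcvg; apply: contrapT => /forallNP tail_oo.
have /choice[w wP] : forall kj : nat * nat, exists zL : (nat -> X) * nat,
    [/\ forall i, `|zL.1 i| <= 1, forall i, (i < kj.1)%N -> zL.1 i = 0,
        forall i, (zL.2 <= i)%N -> zL.1 i = 0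
      & kj.2.+1%:R < `|\sum_(0 <= i < zL.2) B i (zL.1 i)|].
  move=> [k j] /=; have [z [L [z1 zk zL jz]]] :
      exists (z : nat -> X) (L : nat),
    [/\ forall k, `|z k| <= 1, forall i, ~ (k <= i)%N -> z i = 0,
        forall k, (L <= k)%N -> z k = 0
      & j.+1%:R < `|\sum_(0 <= k < L) B k (z k)|].
    apply: (group_norm_witness B [set i | (k <= i)%N]).
    rewrite ltNge; apply/negP => gj; apply: (tail_oo k).
    exact: le_lt_trans gj (ltry _).
  by exists (z, L); split=> // i; rewrite ltnNge => /negP /zk.
(* Block j is [P j, P j.+1), long enough to contain the hump w (P j, j). *)
have [P [P0 Plt wPle]] : exists P : nat -> nat, [/\ P 0%N = 0%N,
    forall j, (P j < P j.+1)%N & forall j, ((w (P j, j)).2 <= P j.+1)%N].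
  exists (fix P j := if j is j'.+1 then
    maxn (w (P j', j')).2 (P j').+1 else 0%N).
  by split=> // j; rewrite ?leq_maxr ?leq_maxl.
have Phomo : {homo P : i j / (i <= j)%N}.
  by apply: homo_leq => [j|j i k|j]; [exact: leqnn|exact: leq_trans|exact/ltnW].
have jP j : (j <= P j)%N by elim: j => // j IHj; apply: leq_ltn_trans (Plt j).
have Pinj i j k : (P j <= i < P j.+1)%N -> (P k <= i < P k.+1)%N -> j = k.
  move=> /andP[ji ij] /andP[ki ik].
  have [jk|kj|//] := ltngtP j k.
    by have := leq_trans (Phomo _ _ jk) ki; rewrite leqNgt ij.
  by have := leq_trans (Phomo _ _ kj) ji; rewrite leqNgt ik.
have /choice[b bP] : forall i, exists j, (P j <= i < P j.+1)%N.
  elim=> [|i [j /andP[ji]]]; first by exists 0%N; have := Plt 0%N; rewrite P0.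
  rewrite leq_eqVlt => /orP[/eqP ij|ij]; last by exists j; rewrite leqW.
  by exists j.+1; rewrite ij leqnn Plt.
pose z i := (w (P i, i)).1.
pose x i := (b i).+1%:R^-1 *: z (b i) i : X.
have x0 : x @ \oo --> 0.
  apply/cvgrPdist_le => e e0.
  have [m em] : exists m : nat, m.+1%:R^-1 <= e.
    exists (Num.truncn e^-1); rewrite invf_ple ?posrE // ltW //.
    by rewrite truncnS_gt.
  exists (P m) => // i /= mi; rewrite sub0r normrN normrZ.
  have [/= z1 _ _ _] := wP (P (b i), b i).
  apply: le_trans em; apply: le_trans (_ : (b i).+1%:R^-1 <= _).
    by rewrite ger0_norm ?invr_ge0 // ler_piMr ?invr_ge0 // /z z1.
  rewrite lef_pV2 ?posrE // ler_nat ltnS leqNgt; apply/negP => bm.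
  by have /andP[_] := bP i; rewrite ltnNge (leq_trans (Phomo _ _ bm) mi).
have /cvg_ex[l sl] := Bcvg x x0.
have /cvgrPdist_lt /(_ (2^-1)) [|m _ ml] := sl; first by rewrite invr_gt0.
have [/= _ zlo zhi zgt] := wP (P m, m).
suff : 1 < `|series (fun k => B k (x k)) (P m.+1) -
           series (fun k => B k (x k)) (P m)|.
  rewrite ltNge => /negP; apply.
  rewrite -[X in `|X|](subrKA l) (le_trans (ler_normD _ _)) // distrC.
  have := ml (P m.+1) (leq_trans (jP m) (ltnW (Plt m))).
  by have := ml (P m) (jP m); rewrite /=; lra.
rewrite (sub_series_geq _ (ltnW (Plt m))).
have -> : \sum_(P m <= k < P m.+1) B k (x k) =
    m.+1%:R^-1 *: \sum_(0 <= k < (w (P m, m)).2) B k (z m k).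
  transitivity (m.+1%:R^-1 *: \sum_(P m <= k < P m.+1) B k (z m k)).
    rewrite scaler_sumr !big_nat; apply: eq_bigr => k kP.
    by rewrite /x (Pinj _ _ _ (bP k) kP) linearZ_LR.
  congr (_ *: _); transitivity (\sum_(0 <= k < P m.+1) B k (z m k)).
    rewrite (big_cat_nat (leq0n (P m)) (ltnW (Plt m))) /=.
    rewrite [X in _ = X + _]big_nat_cond [X in _ = X + _]big1 ?add0r // => k.
    by move=> /andP[/andP[_ km] _]; rewrite /z zlo ?linear0.
  rewrite (big_cat_nat (leq0n _) (wPle m)) /=.
  rewrite [X in _ + X]big_nat_cond [X in _ + X]big1 ?addr0 // => k.
  by move=> /andP[/andP[km _] _]; rewrite /z zhi ?linear0.
by rewrite normrZ ger0_norm ?invr_ge0 // mulrC ltr_pdivlMr // mul1r.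
Qed.

(** * Series with halving weights *)

Section HalvingSeries.
Context {R : realType}.

Lemma halving_sum (c : nat -> R) (p N : nat) : (forall i, 0 <= c i) ->
  (forall i, c i.+1 <= c i / 2) -> \sum_(p <= i < N) c i <= 2 * c p.
Proof.
move=> c0 c2; have [Np|/ltnW pN] := leqP N p.
  by rewrite big_geq // mulr_ge0.
rewrite -(subnK pN) {pN}; move: (N - p)%N => k; elim: k p => [|k IHk] p.
  by rewrite big_geq // mulr_ge0.
rewrite big_ltn; last by rewrite addSn ltnS leq_addl.
by have := IHk p.+1; have := c2 p; rewrite addSnnS; lra.
Qed.

(** Coordinatewise sum of the weighted humps. The remainder after [p] terms is
    bounded uniformly in the coordinate [j], so the sum inherits being null from
    finitely supported humps, and it vanishes at coordinates which no later hump
    meets, so the group norm of a row on a subset of the integers applies to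
    it. *)
Lemma halving_series {X : completeNormedModType R} (c : nat -> R)
    (z : nat -> nat -> X) : (forall i, 0 <= c i) ->
  (forall i, c i.+1 <= c i / 2) -> (forall i j, `|z i j| <= 1) ->
  exists x : nat -> X, forall p j,
    `|x j - \sum_(0 <= i < p) c i *: z i j| <= 2 * c p /\
    ((forall i, (p <= i)%N -> z i j = 0) ->
       x j - \sum_(0 <= i < p) c i *: z i j = 0).
Proof.
move=> c0 c2 z1; pose s j := series (fun i => c i *: z i j).
have cz i j : `|c i *: z i j| <= c i.
  by rewrite normrZ ger0_norm // ler_piMr.
have cs j : cvgn (s j).
  apply: normed_cvg; apply: nondecreasing_is_cvgn.
    apply/nondecreasing_seqP => N; rewrite /normed_series_of !seriesEnat.
    by rewrite /= big_nat_recr //= lerDl.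
  exists (2 * c 0%N) => _ [N _ <-]; rewrite /normed_series_of seriesEnat /=.
  by apply: le_trans (halving_sum c 0%N N c0 c2); apply: ler_sum.
have xe j p e : (forall N, `|\sum_(p <= i < N) c i *: z i j| <= e) ->
    `|limn (s j) - \sum_(0 <= i < p) c i *: z i j| <= e.
  move=> se; have cd : (s j N - s j p) @[N --> \oo] --> limn (s j) - s j p.
    by apply: cvgB; [exact: cs|exact: cvg_cst].
  rewrite -[X in `|X|](cvg_lim _ cd) //; apply: lim_norm_le.
    exact: cvgP cd.
  by exists p => // N /= pN; rewrite sub_series_geq.
exists (fun j => limn (s j)) => p j; split=> [|zp].
  apply: xe => N; apply: le_trans (halving_sum c p N c0 c2).
  by apply: le_trans (ler_norm_sum _ _ _) _; apply: ler_sum.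
apply/eqP; rewrite -normr_le0; apply: xe => N.
rewrite big_nat_cond big1 ?normr0 // => i /andP[/andP[pi _] _].
by rewrite zp ?scaler0.
Qed.

End HalvingSeries.

(** * Uniform boundedness along a strongly selective ideal *)

Definition maps_null_to_null {R : realType} {X Y : normedModType R}
    (A : nat -> nat -> {linear X -> Y}) (J : set (set nat)) : Prop :=
  forall x : nat -> X, x @ \oo --> 0 ->
    (forall n, row_converges A n x) /\ ideal_lim J (mxapply A x) 0.

Section UniformBoundedness.
Context {R : realType} {X : completeNormedModType R} {Y : normedModType R}.
Variables (A : nat -> nat -> {linear X -> Y}) (J : set (set nat)).
Hypotheses (hJ : ideal J) (hJsel : strongly_selective J).
Hypothesis (hA : maps_null_to_null A J).
Variables (E : nat -> set nat) (a : nat -> R).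
Hypotheses (Esub : forall n, E n.+1 `<=` E n) (a0 : forall n, 0 <= a n).
Hypothesis (AEa : forall n, (group_norm (A n) (E n) <= (a n)%:E)%E).

(* The factor 2 ^+ m makes the weights (d m)^-1 halve along any increasing
   sequence of rows; the sum makes d m dominate the norms of all rows of index
   at most m, so that all later humps together contribute at most 2 to those
   rows. *)
Let d m : R := 2 ^+ m * (1 + \sum_(0 <= n < m.+1) a n).

Let d_gt0 m : 0 < d m.
Proof. by rewrite mulr_gt0 ?exprn_gt0 // ltr_pwDl ?sumr_ge0. Qed.

Let a_le_d n : a n <= d n.
Proof.
have s0 : 0 <= \sum_(0 <= i < n) a i by exact: sumr_ge0.
have an := a0 n; rewrite /d big_nat_recr //=.
apply: (@le_trans _ _ (1 + (\sum_(0 <= i < n) a i + a n))); first by lra.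
by rewrite ler_peMl ?exprn_ege1 ?ler1n //; lra.
Qed.

Let d_double m n : (m < n)%N -> 2 * d m <= d n.
Proof.
have dS k : 2 * d k <= d k.+1.
  rewrite /d mulrA -exprS ler_pM2l ?exprn_gt0 //.
  by rewrite [X in _ <= _ + X]big_nat_recr //= lerD2l lerDl.
elim: n => // n IHn; rewrite ltnS leq_eqVlt => /orP[/eqP->|/IHn mn].
  exact: dS.
by apply: (le_trans mn); apply: (le_trans _ (dS n)); have := d_gt0 n; lra.
Qed.

Let d_ge1 m : 1 <= d m.
Proof. by rewrite mulr_ege1 ?exprn_ege1 ?ler1n // lerDl sumr_ge0. Qed.

(* Divided by d m, the hump of level m still has size more than m + 4: at most m
   is lost to the earlier humps and at most 2 to the later ones. *)
Let g m : R := m.+4%:R * d m.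

Let g_leS m : g m <= g m.+1.
Proof.
apply: ler_pM; rewrite ?ler_nat //; first exact: ltW.
by apply: (le_trans _ (d_double _ _ (ltnSn m))); have := d_gt0 m; lra.
Qed.

(** If the group norms were unbounded modulo [J], a null sequence assembled from
    humps along a selected [J]-positive set of rows would have an image that
    does not tend to [0] along [J]. *)
Lemma J_bounded_group_norm : exists m (M : R),
  J [set n | (M%:E < group_norm (A n) (E m))%E].
Proof.
have [Jsub JU Jfin _] := hJ.
apply: contrapT => noM.
have Jpos m M : ~ J [set n | (M%:E < group_norm (A n) (E m))%E].
  by move=> JM; apply: noM; exists m, M.
(* The hump of index (m, n) lives on E m and is large in row n; it is 0 when row
   n has norm at most g m. *)
have /choice[w wP] : forall mn : nat * nat, exists zL : (nat -> X) * nat,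
    [/\ forall k, `|zL.1 k| <= 1, forall k, ~ E mn.1 k -> zL.1 k = 0,
        forall k, (zL.2 <= k)%N -> zL.1 k = 0
      & ((g mn.1)%:E < group_norm (A mn.2) (E mn.1))%E ->
        g mn.1 < `|\sum_(0 <= k < zL.2) A mn.2 k (zL.1 k)|].
  move=> [m n] /=.
  have [/group_norm_witness[z [L [z1 zE zL gz]]]|_] :=
    ltP (g m)%:E (group_norm (A n) (E m)); first by exists (z, L).
  by exists (fun=> 0, 0%N); split=> // k; rewrite normr0.
pose v n p := \sum_(0 <= k < (w p).2) A n k ((w p).1 k).
have v_cvg n p : row_series A n (w p).1 @ \oo --> v n p.
  by apply: row_cvg_finsupp; case: (wP p).
have Jv p : J [set n | 1 <= `|v n p|].
  have [|_ /ideal_limP -/(_ hJ 1 ltr01)] := hA (w p).1.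
    apply: cvg_near_cst; exists (w p).2 => // k /=.
    by case: (wP p) => _ _ + _; exact.
  by apply: Jsub => n /=; rewrite subr0 /mxapply (cvg_lim _ (v_cvg n p)).
(* Rows that may follow row m: large on E m, and small on every hump whose
   indices are at most m, which covers all humps built before row m. *)
pose S m := [set n | ((g m)%:E < group_norm (A n) (E m))%E /\
  forall i j, (i <= m)%N -> (j <= m)%N -> `|v n (i, j)| < 1].
have Spos m : ideal_positive J (S m).
  move=> JS; apply: (Jpos m (g m)).
  pose bad := \bigcup_(i in `I_m.+1) \bigcup_(j in `I_m.+1)
    [set n | 1 <= `|v n (i, j)|].
  have Jbad : J bad by do 2!apply: ideal_bigcup => // ? _; exact: Jv.
  apply: Jsub (JU _ _ JS Jbad) => n /= gn.
  have [nbad|nbad] := pselect (bad n); [by right|left; split=> // i j im jm].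
  by rewrite ltNge; apply/negP => vn; apply: nbad; exists i => //; exists j.
have Sdec m : S m.+1 `<=` S m.
  move=> n [gn vn]; split=> [|i j im jm]; last by apply: vn; exact: leqW.
  apply: le_lt_trans (lt_le_trans gn (group_norm_le _ _ _ (Esub m))).
  by rewrite lee_fin.
have [r [r_lt rpos rS]] := hJsel S Spos Sdec.
have r_homo : {homo r : i j / (i <= j)%N}.
  by apply: homo_leq => [j|j i k|j]; [exact: leqnn|exact: leq_trans|exact/ltnW].
have ir i : (i <= r i)%N.
  by elim: i => // i IHi; apply: leq_ltn_trans (r_lt i).
have E_homo i j : (i <= j)%N -> E j `<=` E i.
  elim: j => [|j IHj]; first by rewrite leqn0 => /eqP ->.
  rewrite leq_eqVlt => /orP[/eqP-> //|/IHj]; exact: subset_trans (Esub j).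
pose c i := (d (r i))^-1; pose z i := (w (r i, r i.+1)).1.
have c0 i : 0 <= c i by rewrite invr_ge0 ltW.
have c2 i : c i.+1 <= c i / 2.
  rewrite /c -invfM lef_pV2 ?posrE; first by rewrite mulrC d_double.
    exact: d_gt0.
  by rewrite mulr_gt0.
have z1 i j : `|z i j| <= 1 by have [+ _ _ _] := wP (r i, r i.+1); exact.
have [x xP] := halving_series c z c0 c2 z1.
have c_small i : c i <= 2^-1 ^+ i.
  elim: i => [|i IHi]; first by rewrite expr0 invf_le1.
  by apply: le_trans (c2 i) _; rewrite exprSr ler_pM2r.
have x_null : x @ \oo --> 0.
  apply/cvgrPdist_le => e e0.
  have /cvgrPdist_lt /(_ _ e0) [p _ /(_ p (leqnn p)) /=] :
      (2 * 2^-1 ^+ n) @[n --> \oo] --> (0 : R).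
    by apply: cvg_geometric; rewrite gtr0_norm ?invr_gt0 // invf_lt1 // ltr1n.
  rewrite sub0r normrN ger0_norm ?mulr_ge0 ?exprn_ge0 ?invr_ge0 // => pe.
  exists (\max_(i < p) (w (r i, r i.+1)).2) => // j /= pj.
  have [+ _] := xP p j; rewrite sub0r normrN big_nat_cond big1 ?subr0 => [xj|].
    apply: (le_trans xj); apply: (le_trans _ (ltW pe)).
    by rewrite ler_pM2l.
  move=> i /andP[/andP[_ ip] _]; case: (wP (r i, r i.+1)) => _ _ zL _.
  rewrite /z zL ?scaler0 //; apply: leq_trans pj.
  exact: (leq_bigmax (Ordinal ip)).
have [x_cvg x_lim] := hA x x_null.
(* Row r i.+1 sees the humps before i, the hump i made for it, and the later
   ones, which all live on E (r i.+1). *)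
have x_big i : 1 <= `|mxapply A x (r i.+1) - 0|.
  rewrite subr0; set n := r i.+1; have [gn vn] := rS i.
  pose p q k := \sum_(0 <= j < q) c j *: z j k.
  have p_cvg q : row_series A n (p q) @ \oo -->
      \sum_(0 <= j < q) c j *: v n (r j, r j.+1).
    elim: q => [|q IHq].
      rewrite big_geq // (_ : p 0%N = fun=> 0).
        have := row_cvg_finsupp A n (fun=> 0) 0%N (fun _ _ => erefl).
        by rewrite big_geq.
      by apply/funext => k; rewrite /p big_geq.
    rewrite big_nat_recr //= (_ : p q.+1 = fun k => p q k + c q *: z q k).
      by apply: row_cvgD => //; exact/row_cvgZ/v_cvg.
    by apply/funext => k; rewrite /p big_nat_recr.
  have t_cvg : row_series A n (fun k => x k - p i.+1 k) @ \oo -->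
      mxapply A x n - \sum_(0 <= j < i.+1) c j *: v n (r j, r j.+1).
    have -> : (fun k => x k - p i.+1 k) = (fun k => x k + -1 *: p i.+1 k).
      by apply/funext => k; rewrite scaleN1r.
    rewrite -[- (\sum_(0 <= j < _) _)]scaleN1r; apply: row_cvgD (x_cvg n) _.
    exact/row_cvgZ/p_cvg.
  have t_le : `|mxapply A x n -
      \sum_(0 <= j < i.+1) c j *: v n (r j, r j.+1)| <= 2.
    apply: (@le_trans _ _ (a n * (2 * c i.+1))).
      apply: (mxapply_bound A n (E n)) t_cvg => // k.
        by case: (xP i.+1 k).
      move=> nEk; case: (xP i.+1 k) => _; apply=> j ij.
      case: (wP (r j, r j.+1)) => _ zE _ _; apply: zE => /= Ejk.
      exact/nEk/(E_homo _ _ (r_homo _ _ ij)).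
    rewrite mulrCA ler_piMr // /c ler_pdivrMr ?d_gt0 // mul1r.
    exact: a_le_d.
  have early_le : `|\sum_(0 <= j < i) c j *: v n (r j, r j.+1)| <= i%:R.
    apply: le_trans (ler_norm_sum _ _ _) _.
    rewrite -[i in leRHS]subn0 -sumr_const_nat !big_nat; apply: ler_sum.
    move=> j /andP[_ ji]; rewrite normrZ ger0_norm //.
    apply: mulr_ile1 => //; first by rewrite invf_le1.
    by rewrite ltW // vn // r_homo // ltnW.
  have block_ge : (r i).+4%:R < `|c i *: v n (r i, n)|.
    have [_ _ _ /(_ gn) /=] := wP (r i, n).
    rewrite normrZ ger0_norm // mulrC -/(v n (r i, n)) => gv.
    by rewrite ltr_pdivlMr.
  have := ir i; rewrite -(ler_nat R) => iri.
  move: t_le block_ge; rewrite big_nat_recr //= -/n.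
  set s := \sum_(0 <= j < i) _ in early_le *.
  set b := c i *: _; move=> t_le block_ge.
  have b_le : `|b| <= `|mxapply A x n| + `|mxapply A x n - (s + b)| + `|s|.
    have {1}-> : b = mxapply A x n - (mxapply A x n - (s + b)) - s.
      by rewrite subKr addrC addKr.
    by apply: le_trans (ler_normB _ _) _; rewrite lerD2r ler_normB.
  have : (r i).+4%:R = (r i)%:R + 4 :> R by rewrite -addn4 natrD.
  by lra.
apply: rpos.
apply: Jsub (JU _ _ (Jfin _ (finite_set1 (r 0%N)))
  ((ideal_limP _ _ hJ).1 x_lim 1 ltr01)) => _ [[|i] _ <-]; first by left.
by right; exact: x_big.
Qed.

End UniformBoundedness.

(** * Regularity *)

Lemma ell_inftyP {R : realType} {V : normedModType R} (x : nat -> V) :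
  ell_infty V x <-> exists M : R, forall k, `|x k| <= M.
Proof.
have nat_proper : ProperFilter (globally [set: nat]).
  exact: (globally_properfilter (a := 0%N)).
split=> [/ex_bound[M xM]|[M xM]]; first by exists M => k; exact: xM.
by apply/ex_bound; exists M => k _; exact: xM.
Qed.

Section Regularity.
Context {R : realType} {X Y : completeNormedModType R}.
Variables (T : {linear X -> Y}) (I J : set (set nat)).
Variable A : nat -> nat -> {linear X -> Y}.
Hypotheses (hI : ideal I) (hJ : ideal J).

Lemma regular_wrt_maps_null : regular_wrt A T I J -> maps_null_to_null A J.
Proof.
move=> [Ac Alim] x x0.
have xc : cb_seq X I x by apply: cvg_cb_seq => //; exact: cvgP x0.
split; first by have [] := Ac x xc.
by rewrite -(linear0 T); apply: Alim => //; exact: cvg_ideal_lim.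
Qed.

Lemma regular_wrt_T345 : regular_wrt A T I J ->
  [/\ T3 A I, T4 A J T & T5 A I J].
Proof.
move=> [Ac Alim]; split=> [x xc|x|x [x0 xb]]; first by have [] := Ac x xc.
- have cx : (fun=> x : X) @ \oo --> x by exact: cvg_cst.
  have xc : cb_seq X I (fun=> x) by apply: cvg_cb_seq => //; exact: cvgP cx.
  by split; [have [] := Ac _ xc|apply: Alim => //; exact: cvg_ideal_lim].
- have xlim : ideal_lim I x 0.
    apply/ideal_limP => // e e0; have [Isub _ _ _] := hI.
    apply: Isub x0 => k /=; rewrite subr0 => ek xk0.
    by move: ek; rewrite xk0 normr0 leNgt e0.
  have xc : cb_seq X I x by split=> //; exists 0.
  by split; [have [] := Ac x xc|rewrite /c0_seq /= -(linear0 T); exact: Alim].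
Qed.

(** The complement of the exceptional set of rows serves as [J0]. *)
Lemma uniform_group_norm (E : nat -> set nat) : strongly_selective J ->
  maps_null_to_null A J -> (forall n, E n.+1 `<=` E n) ->
  (forall n, (group_norm (A n) (E n) < +oo)%E) ->
  exists m J0, ideal_dual J J0 /\
    (ereal_sup [set group_norm (A n) (E m) | n in J0] < +oo)%E.
Proof.
move=> hJsel hA Esub AE.
have /choice[a aP] : forall n, exists a : R,
    0 <= a /\ (group_norm (A n) (E n) <= a%:E)%E.
  by move=> n; have [a a0 Aa] := group_norm_fin _ _ (AE n); exists a.
have [m [M JM]] := J_bounded_group_norm A J hJ hJsel hA E a Esub
  (fun n => (aP n).1) (fun n => (aP n).2).
exists m, (~` [set n | (M%:E < group_norm (A n) (E m))%E]); split.
  by rewrite /ideal_dual /= setCK.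
apply: (@le_lt_trans _ _ M%:E); last exact: ltry.
by apply: ge_ereal_sup => _ [n /= nM <-]; rewrite leNgt; apply/negP.
Qed.

(** Large or early terms of [x - eta] are left to T5; the bound on the rows of
    [J0] controls the rest, up to the rows outside [J0], which form a set of
    [J]. *)
Lemma regular_wrt_sufficient (k0 : nat) (f : nat -> nat) :
  T1flat A J k0 f -> T3 A I -> T4 A J T -> T5 A I J -> regular_wrt A T I J.
Proof.
move=> [J0 [J0J supA _]] hT3 hT4 hT5.
suff Alim x eta : cb_seq X I x -> ideal_lim I x eta ->
    ideal_lim J (mxapply A x) (T eta).
  split=> // x xc; split; first exact: hT3.
  by have [[eta xeta] _] := xc; exists (T eta); exact: Alim.
move=> xc xeta; have [_ /ell_inftyP[C xC]] := xc.
have [M M0 AM] : exists2 M : R, 0 <= M &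
    forall n, J0 n -> (tail_group_norm (A n) k0 <= M%:E)%E.
  move: supA; set s := ereal_sup _ => s_oo.
  have sA n : J0 n -> (tail_group_norm (A n) k0 <= s)%E.
    by move=> Jn; apply: ereal_sup_ubound; exists n.
  case: s s_oo sA => [r|//|] _ sA.
    exists (Num.max r 0) => [|n /sA]; first by rewrite le_max lexx orbT.
    by move=> /le_trans; apply; rewrite lee_fin le_max lexx.
  (* A supremum equal to -oo means that J0 is empty. *)
  exists 0 => // n /sA /le_trans; apply; exact: leNye.
apply/ideal_limP => // e e0.
pose eps := e / (4 * (M + 1)).
have eps0 : 0 < eps by rewrite divr_gt0 // mulr_gt0 // ltr_wpDl.
have Meps : M * eps <= e / 4.
  have -> : M * eps = e / 4 * (M / (M + 1)).
    by rewrite /eps invfM mulrACA [e * M]mulrC -mulrA.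
  apply: ler_piMr; first by apply: divr_ge0; rewrite ?(ltW e0).
  by rewrite ler_pdivrMr ?ltr_wpDl // mul1r lerDl.
pose big k := (k < k0)%N || (eps <= `|x k - eta|).
pose v k := if big k then x k - eta else 0.
pose u k := x k + -1 *: (eta + v k).
have [Isub IU Ifin _] := hI; have [Jsub JU _ _] := hJ.
have v00 : c00b_seq X I v.
  split.
    apply: Isub (IU _ _ (Ifin _ (finite_II k0))
      ((ideal_limP _ _ hI).1 xeta _ eps0)) => k /=.
    by rewrite /v /big; case: ifP => // /orP[? _|? _]; [left|right].
  apply/ell_inftyP; exists (C + `|eta|) => k; rewrite /v; case: ifP => _.
    by apply: le_trans (ler_normB _ _) _; rewrite lerD2r.
  by rewrite normr0 addr_ge0 // (le_trans _ (xC 0%N)).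
have [v_cvg v_lim] := hT5 v v00.
have [eta_cvg eta_lim] := hT4 eta.
have u_le n : J0 n ->
    `|mxapply A x n - (mxapply A (fun=> eta) n + mxapply A v n)| <= e / 4.
  move=> Jn; apply: le_trans Meps; rewrite -scaleN1r.
  apply: (mxapply_bound A n [set k | (k0 <= k)%N] M eps u _ (AM n Jn)).
  - move=> k; rewrite /u /v scaleN1r; case: ifP => [_|/negbT].
      by rewrite [eta + _]addrC subrK subrr normr0 (ltW eps0).
    by rewrite negb_or addr0 => /andP[_]; rewrite -ltNge => /ltW.
  - move=> k /= /negP; rewrite -ltnNge => kk0.
    by rewrite /u /v /big kk0 scaleN1r [eta + _]addrC subrK subrr.
  - apply: row_cvgD; first exact: hT3.
    by apply: row_cvgZ; apply: row_cvgD; [exact: eta_cvg|exact: v_cvg].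
have e4 : 0 < e / 4 by rewrite divr_gt0.
apply: Jsub (JU _ _ (JU _ _ J0J ((ideal_limP _ _ hJ).1 v_lim _ e4))
  ((ideal_limP _ _ hJ).1 eta_lim _ e4)) => n /= en.
apply: contrapT => /not_orP[/not_orP[/contrapT Jn /negP]].
rewrite -ltNge subr0 => vn /negP; rewrite -ltNge => etan.
move: en; rewrite leNgt => /negP; apply.
have -> : mxapply A x n - T eta =
    (mxapply A x n - (mxapply A (fun=> eta) n + mxapply A v n)) +
    mxapply A v n + (mxapply A (fun=> eta) n - T eta).
  by rewrite opprD !addrA subrK subrK.
apply: le_lt_trans (ler_normD _ _) _.
have := ler_normD (mxapply A x n - (mxapply A (fun=> eta) n + mxapply A v n))
  (mxapply A v n).
have := u_le n Jn; lra.
Qed.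

End Regularity.

Theorem theorem2p14 (R : realType) (X Y : completeNormedModType R)
    (T : {linear X -> Y}) (I J : set (set nat))
    (hI : ideal I) (hJ : ideal J) (hJsel : strongly_selective J)
    (A : nat -> nat -> {linear X -> Y}) :
  (regular_wrt A T I J <->
     exists k0 : nat,
       [/\ exists f : nat -> nat, T1flat A J k0 f,
           T3 A I, T4 A J T & T5 A I J])
  /\
  ((forall n k, bounded_fun_norm (A n k)) ->
     (regular_wrt A T I J <->
        [/\ T1flat A J 0 (fun=> 0%N), T3 A I, T4 A J T & T5 A I J])).
Proof.
have tail_finite : regular_wrt A T I J ->
    exists f : nat -> nat, forall n, (tail_group_norm (A n) (f n) < +oo)%E.
  move=> /(regular_wrt_maps_null _ _ _ _ hI) hA.
  have /choice[f Af] : forall n, exists k, (tail_group_norm (A n) k < +oo)%E.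
    by move=> n; apply: row_tail_finite => x x0; exact: (hA x x0).1.
  by exists f.
split=> [|Ab]; split.
- move=> Areg; have hA := regular_wrt_maps_null _ _ _ _ hI Areg.
  have [f Af] := tail_finite Areg.
  (* The tails must decrease with n, while f need not increase. *)
  pose K n := (\sum_(0 <= i < n.+1) f i)%N.
  have [||m [J0 [J0J J0A]]] := uniform_group_norm J A hJ
    (fun n => [set k | (K n <= k)%N]) hJsel hA.
  + move=> n k /=; apply: leq_trans.
    by rewrite /K [leqRHS]big_nat_recr //= leq_addr.
  + move=> n; apply: le_lt_trans (Af n); apply: group_norm_le => k /=.
    by apply: leq_trans; rewrite /K big_nat_recr //= leq_addl.
  have [? ? ?] := regular_wrt_T345 _ _ _ _ hI Areg.
  by exists (K m); split=> //; exists f, J0; split.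
- by move=> [k0 [[f Af] ? ? ?]]; exact: regular_wrt_sufficient Af _ _ _.
- move=> Areg; have hA := regular_wrt_maps_null _ _ _ _ hI Areg.
  have [f Af] := tail_finite Areg.
  have Af0 n : (tail_group_norm (A n) 0 < +oo)%E.
    exact: tail_group_norm_bounded (Ab n) (Af n).
  have [//|//|m [J0 [J0J J0A]]] := uniform_group_norm J A hJ
    (fun=> [set k | (0 <= k)%N]) hJsel hA.
  have [? ? ?] := regular_wrt_T345 _ _ _ _ hI Areg.
  by split=> //; exists J0; split.
- by move=> [Af ? ? ?]; exact: regular_wrt_sufficient Af _ _ _.
Qed.
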